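(* For each of the following sets $R\subseteq\{0,1,2,3\}^2$ we have $(123,R)\sim_d(132,R)$: (1) $R=\{(0,0),(0,2),(0,3),(1,2),(2,0),(2,1),(2,3),(3,0),(3,2)\}$; (2) $R=\{(0,0),(0,2),(0,3),(1,2),(2,0),(2,1),(2,2),(2,3),(3,0),(3,2)\}$; (3) $R=\{(0,0),(0,2),(0,3),(1,1),(1,2),(1,3),(2,0),(2,1),(2,3),(3,0),(3,1),(3,2),(3,3)\}$; (4) $R=\{(0,0),(0,2),(0,3),(1,1),(1,2),(1,3),(2,0),(2,1),(2,2),(2,3),(3,0),(3,1),(3,2),(3,3)\}$.
   Context: $S_n$ denotes the set of permutations of $[n]=\{1,\dots,n\}$, written $\pi=\pi_1\cdots\pi_n$. A mesh pattern of length $k$ is a pair $(\tau,R)$ with $\tau\in S_k$ and $R\subseteq\{0,1,\dots,k\}^2$ (the shaded boxes; box $(a,b)$ is the unit square $[a,a+1]\times[b,b+1]$ in the diagram of $\tau$). An occurrence of $(\tau,R)$ in $\pi\in S_n$ is a choice of indices $i_1<\dots<i_k$ such that $\pi_{i_1}\cdots\pi_{i_k}$ is order-isomorphic to $\tau$ and, with $i_0=0$, $i_{k+1}=n+1$, $v_1<\dots<v_k$ the values $\pi_{i_1},\dots,\pi_{i_k}$ sorted increasingly, $v_0=0$, $v_{k+1}=n+1$, for every $(a,b)\in R$ there is no index $m$ with $i_a<m<i_{a+1}$ and $v_b<\pi_m<v_{b+1}$. Mesh patterns $p,q$ are equidistributed, $p\sim_d q$, if for all $n,\ell\ge0$ the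 number of $\pi\in S_n$ with exactly $\ell$ occurrences of $p$ equals the number with exactly $\ell$ occurrences of $q$. *)

(* Defs.v *)
From mathcomp Require Import all_boot all_fingroup.

Set Implicit Arguments.
Unset Strict Implicit.
Unset Printing Implicit Defensive.

(* Permutations of {1, .., n} are elements of 'S_n, which permute {0, .., n-1}.
   Positions and values are shifted by one (.+1) wherever they are compared
   with the sentinels 0 and n+1; box coordinates are not shifted. *)

Record mesh_pattern (k : nat) := MeshPattern {
  underlying : 'S_k;
  shading : {set 'I_k.+1 * 'I_k.+1}
}.

(* Coordinates greater than k are ignored. *)
Definition boxes (k : nat) (s : seq (nat * nat)) : {set 'I_k.+1 * 'I_k.+1} :=
  [set ab | (val ab.1, val ab.2) \in s].

Section Occurrence.
Variables (k n : nat) (pi : 'S_n).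
Implicit Types (f : {ffun 'I_k -> 'I_n}) (a b : nat).

Definition increasing f := [forall i : 'I_k, forall j : 'I_k, (i < j) ==> (f i < f j)].

Definition order_isomorphic (tau : 'S_k) f :=
  [forall i : 'I_k, forall j : 'I_k, (pi (f i) < pi (f j)) == (tau i < tau j)].

Definition positions f : seq nat := [seq (f j).+1 | j <- enum 'I_k].

Definition values f : seq nat :=
  sort leq [seq (pi (f j)).+1 | j <- enum 'I_k].

(* For s of size k, the sequence 0, s_1, .., s_k, n+1: the final sentinel is
   the default value of nth. *)
Definition with_sentinels (s : seq nat) a : nat := nth n.+1 (0 :: s) a.

Definition empty_box f a b :=
  [forall m : 'I_n,
     ~~ [&& with_sentinels (positions f) a < m.+1,
            m.+1 < with_sentinels (positions f) a.+1,
            with_sentinels (values f) b < (pi m).+1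
          & (pi m).+1 < with_sentinels (values f) b.+1]].

Definition occurrence (p : mesh_pattern k) f :=
  [&& increasing f, order_isomorphic (underlying p) f
    & [forall ab in shading p, empty_box f ab.1 ab.2]].

Definition num_occurrences (p : mesh_pattern k) : nat :=
  #|[set f : {ffun 'I_k -> 'I_n} | occurrence p f]|.

End Occurrence.

Definition equidistributed (k k' : nat)
    (p : mesh_pattern k) (q : mesh_pattern k') : Prop :=
  forall n l : nat,
    #|[set pi : 'S_n | num_occurrences pi p == l]| =
    #|[set pi : 'S_n | num_occurrences pi q == l]|.

Notation "p ~d q" := (equidistributed p q) (at level 70, no associativity).

Definition one_line (k : nat) (tau : 'S_k) : seq nat :=
  [seq (tau i).+1 | i <- enum 'I_k].

Definition perm123 : 'S_3 := 1%g.
Definition perm132 : 'S_3 :=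
  tperm (Ordinal (isT : 1 < 3)) (Ordinal (isT : 2 < 3)).

Lemma one_line_perm123 : one_line perm123 = [:: 1; 2; 3].
Proof. by rewrite /one_line !enum_ordSl enum_ord0 /= !perm1. Qed.

Lemma one_line_perm132 : one_line perm132 = [:: 1; 3; 2].
Proof. by rewrite /one_line !enum_ordSl enum_ord0 /= !permE. Qed.

(* Main.v *)
(* An occurrence consists of a block, i.e. a set of consecutive positions whose
   values are also consecutive, which starts at its minimum and ends at its
   maximum (for 123) or the other way round (for 132), together with a point
   anchoring it from the lower left; the condition on the anchor involves the
   block only as a set of positions and a set of values.  An anchor never lies
   in an anchored block, because it is a left-to-right minimum while the points
   of an anchored block are not.  Hence the union of two overlapping anchored
   blocks is anchored (for shadings (3) and (4) they even coincide), the maximal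
   anchored blocks are disjoint, and reversing each of them is an involution of
   S_n that keeps the anchors and exchanges the two kinds of occurrences. *)

Require Import Defs.
From mathcomp Require Import all_boot all_fingroup.
From mathcomp Require Import zify.

Set Implicit Arguments.
Unset Strict Implicit.
Unset Printing Implicit Defensive.

(** * Anchored blocks, their overlaps and unions *)

Section Anchored.
Variables (n : nat) (strict : bool).
Implicit Types (pi s : 'S_n) (i j k m x y : 'I_n).

(* All shading conditions except those on the order of the points within the
   block of positions j, .., k.  Shadings (1) and (2) correspond to ~~ strict,
   shadings (3) and (4) to strict. *)
Definition anchored pi i j k : bool :=
  [&& i < j, j <= k,
    [forall m : 'I_n, forall x : 'I_n, forall y : 'I_n,
      ~~ (j <= m <= k) ==> (j <= x <= k) ==> (j <= y <= k) ==>
      ((pi m < pi x) == (pi m < pi y))],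
    [forall x : 'I_n, (j <= x <= k) ==> (pi i < pi x)]
  & [&& [forall m : 'I_n, (m < i) ==> (pi i < pi m)],
        [forall m : 'I_n, forall x : 'I_n,
          (m < i) ==> (j <= x <= k) ==> (pi m < pi x)],
        [forall m : 'I_n, (pi m < pi i) ==> (m < j)]
      & strict ==> [forall m : 'I_n,
          (m <= k) && ((i < m < j) ==> (pi m < pi i))]]].

Lemma anchoredP pi i j k : reflect
  [/\ i < j, j <= k,
      (forall m x y, ~~ (j <= m <= k) -> j <= x <= k -> j <= y <= k ->
         (pi m < pi x) = (pi m < pi y)),
      (forall x, j <= x <= k -> pi i < pi x)
    & [/\ forall m, m < i -> pi i < pi m,
          forall m x, m < i -> j <= x <= k -> pi m < pi x,
          forall m, pi m < pi i -> m < j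
        & strict -> forall m, m <= k /\ (i < m < j -> pi m < pi i)]]
  (anchored pi i j k).
Proof.
apply: (iffP and5P) => [] [ij jk].
  move=> /forallP A /forallP B /and4P[/forallP C /forallP D /forallP E /implyP F].
  split=> //.
  - move=> m x y hm hx hy; move: (A m) => /forallP/(_ x)/forallP/(_ y).
    by rewrite hm hx hy /= => /eqP.
  - by move=> x; apply/implyP.
  split.
  - by move=> m; apply/implyP.
  - move=> m x hm hx; move: (D m) => /forallP/(_ x).
    by rewrite hm hx.
  - by move=> m; apply/implyP.
  - by move=> t m; have /forallP/(_ m)/andP[? /implyP] := F t.
move=> A B [C D E F]; split=> //; last apply/and4P; last split.
- apply/forallP => m; apply/forallP => x; apply/forallP => y.
  by do 3!apply/implyP => ?; apply/eqP; apply: A.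
- by apply/forallP => x; apply/implyP; apply: B.
- by apply/forallP => x; apply/implyP; apply: C.
- apply/forallP => m; apply/forallP => x.
  by do 2!apply/implyP => ?; apply: D.
- by apply/forallP => x; apply/implyP; apply: E.
- apply/implyP => t; apply/forallP => m.
  by have [-> ?] := F t m; apply/implyP.
Qed.

Lemma anchor_notin_anchored pi i j k i' j' k' :
  anchored pi i j k -> anchored pi i' j' k' -> ~~ (j' <= i <= k').
Proof.
move=> /anchoredP[_ _ _ _ [C _ _ _]] /anchoredP[ij' _ _ B' _].
apply/negP => hi; have := B' _ hi; have := C i'; lia.
Qed.

(** Suppose [j < j']. As [k] is the last position, [i'] lies before [j], and [j] lies between [i']
    and [j'], so [pi j < pi i']. Wherever [i'] sits relative to [i], this contradicts the anchoring
    of [j] by [i]. *)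
Lemma strict_anchored_le pi i j k i' j' k' : strict ->
  anchored pi i j k -> anchored pi i' j' k' -> j' <= j.
Proof.
move=> t P Q; have := anchor_notin_anchored Q P.
case/anchoredP: P => ij jk A B [C D E /(_ t) F].
case/anchoredP: Q => ij' jk' A' B' [C' D' E' /(_ t) F'] ni.
rewrite leqNgt; apply/negP => lt.
have [hi _] := F i'.
have lt' : i' < j by lia.
have [_ /(_ _) h] := F' j.
have {}h : pi j < pi i' by apply: h; lia.
have hj : j <= j <= k by rewrite leqnn.
case: (ltngtP i' i) => hii.
- have := D _ _ hii hj; lia.
- have [_ g] := F i'; have := B _ hj.
  have : pi i' < pi i by apply: g; lia.
  lia.
- have /val_inj e := hii; have := B _ hj; rewrite -e; lia.
Qed.

Lemma strict_anchored_uniq pi i j k i' j' k' : strict ->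
  anchored pi i j k -> anchored pi i' j' k' -> j = j' /\ k = k'.
Proof.
move=> t P Q.
have h1 := strict_anchored_le t P Q; have h2 := strict_anchored_le t Q P.
case/anchoredP: P => _ _ _ _ [_ _ _ /(_ t k')[h3 _]].
case/anchoredP: Q => _ _ _ _ [_ _ _ /(_ t k)[h4 _]].
by split; apply/val_inj/eqP; rewrite eqn_leq ?h1 ?h2 ?h3 ?h4.
Qed.

Definition omin j j' : 'I_n := if j <= j' then j else j'.
Definition omax j j' : 'I_n := if j <= j' then j' else j.

(** Comparisons pass from one block to the other through a shared point [z]; [i] lies outside both
    blocks, so this applies to it as well. *)
Lemma anchored_union pi i j k i' j' k' :
  anchored pi i j k -> anchored pi i' j' k' -> j <= k' -> j' <= k ->
  anchored pi i (omin j j') (omax k k').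
Proof.
move=> P Q o1 o2; have [t|/negbTE t] := boolP strict.
  have [<- <-] := strict_anchored_uniq t P Q.
  by rewrite /omin /omax !leqnn.
have ni := anchor_notin_anchored P Q.
case/anchoredP: P => ij jk A B [C D E _].
case/anchoredP: Q => ij' jk' A' B' [C' D' E' _].
have vmin : omin j j' = minn j j' :> nat by rewrite /omin; case: ifP; lia.
have vmax : omax k k' = maxn k k' :> nat by rewrite /omax; case: ifP; lia.
pose z := omax j j'.
have vz : z = maxn j j' :> nat by rewrite /z /omax; case: ifP; lia.
have z1 : j <= z <= k by lia.
have z2 : j' <= z <= k' by lia.
have split_mem (x : 'I_n) : minn j j' <= x <= maxn k k' ->
  (j <= x <= k) || (j' <= x <= k') by lia.
have Biz := B _ z1.
have BB (x : 'I_n) : minn j j' <= x <= maxn k k' -> pi i < pi x.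
  move=> /split_mem/orP[/B//|hx].
  by rewrite (A' i x z) //; lia.
apply/anchoredP; rewrite vmin vmax t; split=> //; try lia.
  move=> m x y hm hx hy.
  have to_z (w : 'I_n) : minn j j' <= w <= maxn k k' -> (pi m < pi w) = (pi m < pi z).
    by move=> /split_mem/orP[] hw; [apply: A | apply: A'] => //; lia.
  by rewrite !to_z.
split=> //.
- move=> m x hm /split_mem/orP[|hx]; first exact: D.
  rewrite (A' m x z) //; first exact: D.
  by lia.
- move=> m hm; have h := E _ hm.
  have : ~~ (minn j j' <= m <= maxn k k') by apply/negP => /BB; lia.
  by lia.
Qed.

Lemma anchored_reorder pi s i j k :
  s i = i -> (forall m, (s m < i) = (m < i)) ->
  (forall m, (s m < j) = (m < j)) -> (forall m, (s m <= k) = (m <= k)) ->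
  anchored pi i j k -> anchored (s * pi)%g i j k.
Proof.
move=> si hi hj hk /anchoredP[ij jk A B [C D E F]].
have hjk m : (j <= s m <= k) = (j <= m <= k) by rewrite hk leqNgt hj -leqNgt.
apply/anchoredP; split=> //.
- by move=> m x y hm hx hy; rewrite !permM; apply: A; rewrite hjk.
- by move=> x hx; rewrite !permM si; apply: B; rewrite hjk.
split.
- by move=> m hm; rewrite !permM si; apply: C; rewrite hi.
- by move=> m x hm hx; rewrite !permM; apply: D; rewrite ?hjk ?hi.
- by move=> m; rewrite !permM si -hj; apply: E.
- move=> t m; have [h1 h2] := F t (s m); rewrite -hk; split=> // hm.
  rewrite !permM si; apply: h2.
  have := hi m; have := hj m.
  (* The cut at [i] gives only [i <= s m]; injectivity excludes equality. *)
  have : s m != i by rewrite -si (inj_eq perm_inj) -val_eqE /=; lia.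
  rewrite -val_eqE /=; lia.
Qed.

(** * Maximal anchored blocks *)

Definition inside m (q : 'I_n * 'I_n) := q.1 <= m <= q.2.

Definition in_anchored pi m (q : 'I_n * 'I_n) : bool :=
  inside m q && [exists i, anchored pi i q.1 q.2].

(** The singleton [(m, m)] serves the points that lie in no anchored block. *)
Definition block pi m : 'I_n * 'I_n :=
  [arg max_(q > (m, m) | (q == (m, m)) || in_anchored pi m q) (q.2 - q.1)].

Lemma in_anchoredP pi m q :
  reflect (inside m q /\ exists i, anchored pi i q.1 q.2) (in_anchored pi m q).
Proof. by apply: (iffP andP) => [] [? /existsP]. Qed.

Variant block_spec pi m (p : 'I_n * 'I_n) : Prop :=
  BlockSpec of inside m p
    & (p = (m, m) \/ exists i, anchored pi i p.1 p.2)
    & (forall i q, anchored pi i q.1 q.2 -> inside m q ->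
         p.1 <= q.1 /\ q.2 <= p.2).

(** Maximal length implies maximality for inclusion: the union with another anchored block through
    [m] is anchored, so it cannot be longer. *)
Lemma blockP pi m : block_spec pi m (block pi m).
Proof.
rewrite /block; case: arg_maxnP; first by rewrite eqxx.
case=> lo hi /orP[/eqP[-> ->] max|/in_anchoredP[/= ins [i0 P]] max].
  split; rewrite ?/inside /= ?leqnn //; first by left.
  move=> i q Q hq; have /andP[q1 q2] := hq.
  have : in_anchored pi m q by apply/in_anchoredP; split=> //; exists i.
  move/(fun h => max q (introT orP (or_intror h))) => /=; lia.
split=> //=; first by right; exists i0.
move=> i [lo' hi'] /= Q hq; move: (ins) (hq); rewrite /inside /= => ins' hq'.
have U := anchored_union P Q ltac:(lia) ltac:(lia).
have /= := max (omin lo lo', omax hi hi').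
have -> : in_anchored pi m (omin lo lo', omax hi hi').
  apply/in_anchoredP; split; last by exists i0.
  by rewrite /inside /omin /omax /=; do 2!case: ifP; lia.
rewrite orbT => /(_ isT); rewrite /omin /omax; do 2!case: ifP; lia.
Qed.

Lemma insideP m x : inside x (m, m) -> x = m.
Proof. by rewrite /inside /= => ?; apply: val_inj => /=; lia. Qed.

Lemma block_inside pi m : inside m (block pi m).
Proof. by case: (blockP pi m). Qed.

(** By maximality at [x], the block of [m] lies in that of [x]; the latter then contains [m] and
    lies in the block of [m] in turn. *)
Lemma block_same pi m x : inside x (block pi m) -> block pi x = block pi m.
Proof.
case: (blockP pi m) => ins [e _|[i P] max]; first by rewrite {1}e => /insideP ->.
move=> hx; case: (blockP pi x) => ins' H max'.
have [h1 h2] := max' _ _ P hx.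
have h3 : (block pi m).1 <= (block pi x).1 /\ (block pi x).2 <= (block pi m).2.
  case: H => [e|[i' Q]].
    by move: hx; rewrite e /inside /= => /andP[].
  by apply: (max i' _ Q); move: ins; rewrite /inside; lia.
case: h3 => h3 h4.
rewrite [RHS]surjective_pairing [LHS]surjective_pairing.
by congr (_, _); apply/val_inj/eqP => /=; lia.
Qed.

(** * Reflection of all maximal blocks *)

Definition flip_fun pi m : 'I_n :=
  insubd m ((block pi m).1 + (block pi m).2 - m).

Lemma val_flip_fun pi m :
  flip_fun pi m = (block pi m).1 + (block pi m).2 - m :> nat.
Proof.
have := block_inside pi m; rewrite /inside => ?.
by rewrite val_insubd ifT //; have := ltn_ord (block pi m).2; lia.
Qed.

Lemma flip_fun_inside pi m : inside (flip_fun pi m) (block pi m).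
Proof.
have := block_inside pi m; rewrite /inside val_flip_fun; lia.
Qed.

Lemma flip_funK pi : involutive (flip_fun pi).
Proof.
move=> m; apply/val_inj => /=; rewrite !val_flip_fun.
rewrite (block_same (flip_fun_inside pi m)).
have := block_inside pi m; rewrite /inside; lia.
Qed.

Definition flip pi : 'S_n := perm (inv_inj (flip_funK pi)).

Lemma val_flip pi m : flip pi m = (block pi m).1 + (block pi m).2 - m :> nat.
Proof. by rewrite permE val_flip_fun. Qed.

Lemma flip_inside pi m : inside (flip pi m) (block pi m).
Proof. by rewrite permE flip_fun_inside. Qed.

Lemma flipK pi : involutive (flip pi).
Proof. by move=> m; rewrite !permE flip_funK. Qed.

(** The interval from [j] to [k] is a union of blocks, so [flip pi] maps it to itself. *)
Definition flip_closed pi j k := forall m, j <= m <= k ->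
  j <= (block pi m).1 /\ (block pi m).2 <= k.

Lemma flip_closed_lt pi j k m : j <= k -> flip_closed pi j k ->
  (flip pi m < j) = (m < j).
Proof.
move=> jk H; have [h1 h2] : j <= (block pi j).1 /\ (block pi j).2 <= k.
  by apply: H; lia.
have F := flip_inside pi m; have B := block_inside pi m.
(* A block containing [j] starts at [j]; any other lies on one side of [j]. *)
have [hj|hj] := boolP (inside j (block pi m)).
  have e := block_same hj; move: F B; rewrite -e /inside; lia.
move: F B hj; rewrite /inside; lia.
Qed.

Lemma flip_closed_le pi j k m : j <= k -> flip_closed pi j k ->
  (flip pi m <= k) = (m <= k).
Proof.
move=> jk H; have [h1 h2] : j <= (block pi k).1 /\ (block pi k).2 <= k.
  by apply: H; lia.
have F := flip_inside pi m; have B := block_inside pi m.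
have [hj|hj] := boolP (inside k (block pi m)).
  have e := block_same hj; move: F B; rewrite -e /inside; lia.
move: F B hj; rewrite /inside; lia.
Qed.

(** [tau] is separate from [pi] so that the blocks of [pi] can also be reflected in
    [reflect_blocks pi], which leads back to [pi]. *)
Lemma anchored_flip pi tau i j k :
  block pi i = (i, i) -> flip_closed pi j k ->
  anchored tau i j k -> anchored (flip pi * tau)%g i j k.
Proof.
move=> bi cl P; have jk : j <= k by case/anchoredP: P.
have ci : flip_closed pi i i.
  by move=> m hm; rewrite -(insideP hm) in bi; rewrite bi -(insideP hm) leqnn.
apply: anchored_reorder P => [||m|m].
- by apply: insideP; rewrite -bi flip_inside.
- by move=> m; apply: flip_closed_lt ci.
- exact: flip_closed_lt jk cl.
- exact: flip_closed_le jk cl.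
Qed.

Lemma block_anchor pi i j k : anchored pi i j k -> block pi i = (i, i).
Proof.
move=> P; case: (blockP pi i) => ins [//|[i' Q]] _.
by have := anchor_notin_anchored P Q; move: ins; rewrite /inside => ->.
Qed.

Lemma block_closed pi m : flip_closed pi (block pi m).1 (block pi m).2.
Proof. by move=> x /block_same ->. Qed.

Definition reflect_blocks pi : 'S_n := (flip pi * pi)%g.

Lemma anchored_reflect_blocks pi m i :
  anchored pi i (block pi m).1 (block pi m).2 ->
  anchored (reflect_blocks pi) i (block pi m).1 (block pi m).2.
Proof.
move=> P; apply: anchored_flip (block_anchor P) _ P; exact: block_closed.
Qed.

Lemma flip_reflect_blocks pi : (flip pi * reflect_blocks pi)%g = pi.
Proof. by apply/permP => m; rewrite !permM flipK. Qed.

Lemma sub_block_reflect_blocks pi m :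
  (block (reflect_blocks pi) m).1 <= (block pi m).1 /\
  (block pi m).2 <= (block (reflect_blocks pi) m).2.
Proof.
case: (blockP (reflect_blocks pi) m) => ins' _ max'.
case: (blockP pi m) => ins [e _|[i P] _]; first by rewrite e; apply/andP.
by apply: (max' i) => //; apply: anchored_reflect_blocks.
Qed.

(** Blocks of [pi] stay anchored, so blocks can only grow. A block of the image is thus a union of
    blocks of [pi], and its anchor is a singleton block of [pi]; reflecting back shows that it was
    already anchored in [pi]. *)
Lemma block_reflect_blocks pi m : block (reflect_blocks pi) m = block pi m.
Proof.
set rho := reflect_blocks pi.
have := sub_block_reflect_blocks pi; rewrite -/rho => sub.
have [h1 h2] := sub m.
suff [h3 h4] : (block pi m).1 <= (block rho m).1 /\
               (block rho m).2 <= (block pi m).2.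
  rewrite [RHS]surjective_pairing [LHS]surjective_pairing.
  by congr (_, _); apply/val_inj/eqP => /=; lia.
case: (blockP rho m) => ins' [e|[i P]] _.
  by rewrite e; have := block_inside pi m; rewrite /inside => /andP[].
have bi : block pi i = (i, i).
  have := sub i; have := block_inside pi i.
  rewrite (block_anchor P) /inside /= => ? ?.
  by rewrite [LHS]surjective_pairing; congr (_, _); apply/val_inj/eqP => /=; lia.
have cl : flip_closed pi (block rho m).1 (block rho m).2.
  by move=> x /block_same <-; apply: sub.
have Q := anchored_flip bi cl P.
rewrite flip_reflect_blocks in Q.
by case: (blockP pi m) => _ _ max; apply: (max i).
Qed.

Lemma reflect_blocksK : involutive reflect_blocks.
Proof.
move=> pi; rewrite {1}/reflect_blocks.
suff -> : flip (reflect_blocks pi) = flip pi by exact: flip_reflect_blocks.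
by apply/permP => m; apply/val_inj => /=; rewrite !val_flip block_reflect_blocks.
Qed.

End Anchored.

(** * Reflection of an occurrence inside its maximal block *)

Section BlockOccurrence.
Variables (n : nat) (strict adjacent : bool).
Implicit Types (pi : 'S_n) (i j k m x y : 'I_n).

(** The hypothesis [~~ strict] is there because a strict block must end at the last position, which
    a subinterval need not do. *)
Lemma anchored_sub pi i lo hi j k : ~~ strict ->
  anchored strict pi i lo hi -> lo <= j -> j <= k -> k <= hi ->
  (forall m x y, ~~ (j <= m <= k) -> j <= x <= k -> j <= y <= k ->
     (pi m < pi x) = (pi m < pi y)) ->
  anchored strict pi i j k.
Proof.
move=> /negbTE t /anchoredP[ilo lohi _ B [C D E _]] loj jk khi A.
apply/anchoredP; rewrite t; split=> //; first lia.
  by move=> x hx; apply: B; lia.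
split=> // [m x hm hx|m /E]; last lia.
by apply: D; lia.
Qed.

Definition block_occurrence (up : bool) pi i j k : bool :=
  [&& anchored strict pi i j k, j < k, adjacent ==> (k == j.+1 :> nat)
    & [forall m : 'I_n, (j <= m <= k) ==>
        if up then pi j <= pi m <= pi k else pi k <= pi m <= pi j]].

Local Notation block := (block strict).
Local Notation flip := (flip strict).
Local Notation reflect_blocks := (reflect_blocks strict).

(** The maximal block may come with another anchor, but its union with the interval from [j] to [k]
    is itself, and a union inherits the first anchor. *)
Lemma anchored_block pi i j k : anchored strict pi i j k ->
  [/\ anchored strict pi i (block pi j).1 (block pi j).2,
      (block pi j).1 <= j & k <= (block pi j).2].
Proof.
move=> P; have jk : j <= k by case/anchoredP: P.
have jj : inside j (j, k) by rewrite /inside leqnn.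
case: (blockP strict pi j) => ins H max.
have /= [h1 h2] := max i (j, k) P jj.
split=> //; case: H => [e|[i' Q]].
  move: h2; rewrite e /= => h2.
  suff ejk : j = k by rewrite {2}ejk.
  by apply/val_inj/eqP; rewrite eqn_leq jk.
have := anchored_union P Q ltac:(lia) ltac:(lia).
rewrite /omin /omax h2.
case: leqP => [h|//]; suff <- : j = (block pi j).1 by [].
by apply/val_inj/eqP; rewrite eqn_leq h h1.
Qed.

Lemma block_occurrence_reflect up pi i j k :
  block_occurrence up pi i j k ->
  block_occurrence (~~ up) (reflect_blocks pi) i (flip pi k) (flip pi j).
Proof.
case/and4P=> P jk adj /forallP ext.
have [Q loj khi] := anchored_block P.
have kin : inside k (block pi j) by rewrite /inside khi; lia.
have vj := val_flip strict pi j.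
have vk := val_flip strict pi k; rewrite (block_same kin) in vk.
(* [flip pi] mirrors the block of [j] and keeps all other points outside it. *)
have mem m : (flip pi k <= m <= flip pi j) = (j <= flip pi m <= k).
  have [hm|hm] := boolP (inside m (block pi j)).
    have := val_flip strict pi m; rewrite (block_same hm).
    by move: hm; rewrite /inside; lia.
  have : ~~ inside (flip pi m) (block pi j).
    apply: contra hm => hm.
    by rewrite -(block_same hm) -{1}(flipK strict pi m) flip_inside.
  by move: hm; rewrite /inside; lia.
apply/and4P; split; first last.
- apply/forallP => m; apply/implyP; rewrite mem => hm.
  have /implyP/(_ hm) := ext (flip pi m).
  by rewrite !permM !flipK; case: up ext.
- apply: contraLR adj; rewrite !negb_imply => /andP[-> ] /=; lia.
- lia.
have R := anchored_reflect_blocks Q.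
(* In the strict case the interval is the whole block; otherwise it is a subinterval of the
   reflected block. *)
have /orP[t|t] : strict || ~~ strict := orbN _.
  have [ej ek] := strict_anchored_uniq t P Q.
  have -> : flip pi k = (block pi j).1.
    by apply: val_inj => /=; rewrite vk -ek addnK.
  have -> // : flip pi j = (block pi j).2.
  by apply: val_inj => /=; rewrite vj -ej addKn.
apply: anchored_sub R _ _ _ _ => //; try lia.
move=> m x y; rewrite !mem => hm hx hy; rewrite !permM.
by case/anchoredP: P => _ _ A _ _; apply: A.
Qed.

End BlockOccurrence.

(** * Translation of the shaded boxes into conditions on the block *)

(* Shading box (2, 2) forces the block to consist of two points, which is what
   adjacent records. *)
Definition shaded (strict adjacent : bool) : seq (nat * nat) :=
  match strict, adjacent with
  | false, false =>
    [:: (0,0); (0,2); (0,3); (1,2); (2,0); (2,1); (2,3); (3,0); (3,2)]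
  | false, true =>
    [:: (0,0); (0,2); (0,3); (1,2); (2,0); (2,1); (2,2); (2,3); (3,0); (3,2)]
  | true, false =>
    [:: (0,0); (0,2); (0,3); (1,1); (1,2); (1,3); (2,0); (2,1); (2,3);
        (3,0); (3,1); (3,2); (3,3)]
  | true, true =>
    [:: (0,0); (0,2); (0,3); (1,1); (1,2); (1,3); (2,0); (2,1); (2,2);
        (2,3); (3,0); (3,1); (3,2); (3,3)]
  end.

Definition in_box n (p v : seq nat) (x y : nat) (ab : nat * nat) : bool :=
  [&& with_sentinels n p ab.1 < x, x < with_sentinels n p ab.1.+1,
      with_sentinels n v ab.2 < y & y < with_sentinels n v ab.2.+1].

(** Each of the seven places relative to three increasing points fixes all nine comparisons at once,
    so one case analysis decides every box. *)
Variant location_spec :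
    bool -> bool -> bool -> bool -> bool -> bool -> bool -> bool -> bool -> Prop :=
  | Below1 : location_spec true false false true false false true false false
  | At1 : location_spec false true false true false false true false false
  | Between12 : location_spec false false true true false false true false false
  | At2 : location_spec false false true false true false true false false
  | Between23 : location_spec false false true false false true true false false
  | At3 : location_spec false false true false false true false true false
  | Above3 : location_spec false false true false false true false false true.

Lemma locationP i j k x : i < j < k ->
  location_spec (x < i) (x == i) (i < x) (x < j) (x == j) (j < x)
                (x < k) (x == k) (k < x).
Proof.
case: (ltngtP x i) => h1; case: (ltngtP x j) => h2; case: (ltngtP x k) => h3;
  solve [by constructor | lia].
Qed.

(** Each conjunct collects the unshaded rows of one column. The two equations keep the other points
    of the permutation off the grid lines; the second is symmetric in [j] and [k], so it covers 123
    and 132 alike. *)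
Lemma unshadedE n strict adjacent i j k a b c x y :
  i < j < k -> a < b < c -> x < n -> y < n ->
  (x == i) = (y == a) -> (x == j) || (x == k) = (y == b) || (y == c) ->
  all (fun ab => ~~ in_box n [:: i.+1; j.+1; k.+1] [:: a.+1; b.+1; c.+1]
                      x.+1 y.+1 ab) (shaded strict adjacent) =
  [&& (x < i) ==> (a < y < b),
      (i < x < j) ==> (if strict then y < a else (y < b) || (c < y)),
      (j < x < k) ==> ~~ adjacent && (b < y < c)
    & (k < x) ==> ~~ strict && (a < y) && ((y < b) || (c < y))].
Proof.
move=> hp hv xn yn; rewrite /in_box /with_sentinels.
case: strict; case: adjacent; rewrite /= !ltnS xn yn;
  by case: (locationP x hp); case: (locationP y hv).
Qed.

Lemma forall_boxes k (s : seq (nat * nat)) (P : nat -> nat -> bool) :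
  all (fun ab => (ab.1 <= k) && (ab.2 <= k)) s ->
  [forall ab in boxes k s, P (val ab.1) (val ab.2)] =
  all (fun ab => P ab.1 ab.2) s.
Proof.
move=> /allP bound; apply/forall_inP/allP => [H [a b] ab|H ab].
  have /= /andP[ak bk] := bound _ ab.
  have := H (inord a, inord b); rewrite inE /= !inordK //; exact.
by rewrite inE => /H.
Qed.

(** [b] and [c] are the positions of the middle and the greatest value. The boxes say that the
    values from [pi b] to [pi c] occur exactly at the positions from [j] to [k], together with the
    conditions on the anchor. *)
Lemma forall_unshadedE n strict adjacent up (pi : 'S_n) (i j k : 'I_n) :
  let b := if up then j else k in let c := if up then k else j in
  i < j < k -> pi i < pi b < pi c ->
  [forall m : 'I_n,
    all (fun ab => ~~ in_box n [:: i.+1; j.+1; k.+1]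
                        [:: (pi i).+1; (pi b).+1; (pi c).+1]
                        m.+1 (pi m).+1 ab) (shaded strict adjacent)] =
  block_occurrence strict adjacent up pi i j k.
Proof.
move=> b c hp hv.
have val_inE (m x : 'I_n) : (m == x :> nat) = (pi m == pi x :> nat).
  by rewrite !val_eqE (inj_eq perm_inj).
transitivity [forall m : 'I_n,
  [&& (m < i) ==> (pi i < pi m < pi b),
      (i < m < j) ==> (if strict then pi m < pi i
                       else (pi m < pi b) || (pi c < pi m)),
      (j < m < k) ==> ~~ adjacent && (pi b < pi m < pi c)
    & (k < m) ==> ~~ strict && (pi i < pi m) &&
                  ((pi m < pi b) || (pi c < pi m))]].
  apply: eq_forallb => m; apply: unshadedE => //.
  - by rewrite (val_inE m j) (val_inE m k) /b /c; case: (up); rewrite // orbC.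
apply/forallP/idP => [H|].
  have Hb (m : 'I_n) : j <= m <= k -> pi b <= pi m <= pi c.
    move=> hm; have /and4P[_ _ /implyP h _] := H m.
    case: (ltngtP m j) => [|h1|/val_inj ->]; first lia.
      case: (ltngtP m k) => [h2||/val_inj ->]; last 1 first.
      + by move: hv; rewrite /b /c; case: (up); lia.
      + by move: h; rewrite h1 h2 => /(_ isT)/andP[_]; lia.
      + lia.
    by move: hv; rewrite /b /c; case: (up); lia.
  have Hout (m : 'I_n) : ~~ (j <= m <= k) -> (pi m < pi b) || (pi c < pi m).
    move=> hm; have /and4P[h1 h2 h3 h4] := H m; have := val_inE m i.
    move: h1 h2 h4; case: (strict); lia.
  apply/and4P; split; last 2 first.
  (* Position [j + 1], if before [k], would carry a point in column 2, all of whose boxes are shaded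
     when [adjacent] holds. *)
  - apply/implyP => a; have [h|] := boolP (j.+1 < k); last lia.
    have jn : j.+1 < n by have := ltn_ord k; lia.
    have /and4P[_ _ ] := H (Ordinal jn); rewrite a /=; lia.
  - apply/forallP => m; apply/implyP => /Hb.
    by rewrite /b /c; case: (up).
  - apply/anchoredP; split; try lia.
    + move=> m x y /Hout hm /Hb hx /Hb hy; lia.
    + move=> x /Hb; lia.
    split.
    + move=> m hm; have /and4P[] := H m; lia.
    + move=> m x hm /Hb hx; have /and4P[] := H m; lia.
    + move=> m hm; rewrite ltnNge; apply/negP => hj.
      have [hk|hk] := boolP (m <= k).
        have := Hb m; lia.
      have /and4P[] := H m; lia.
    + move=> t m; have /and4P[] := H m; rewrite t; lia.
  - lia.
case/and4P=> /anchoredP[ij jk A B [C D E F]] jltk adj /forallP ext m.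
have Hb (x : 'I_n) : j <= x <= k -> pi b <= pi x <= pi c.
  by move=> hx; have /implyP/(_ hx) := ext x; rewrite /b /c; case: (up).
have inb : j <= b <= k by rewrite /b; case: (up); lia.
have inc : j <= c <= k by rewrite /c; case: (up); lia.
(* A point outside the block lies on the same side of [pi b] and [pi c], hence not between them. *)
have Ebc := A m b c _ inb inc.
have nb := val_inE m b; have nc := val_inE m c; have ni := val_inE m i.
have Bi := B m; have Ci := C m; have Di := D m b; have Ei := E m; have Hm := Hb m.
apply/and4P; split; apply/implyP => h.
- by rewrite Ci // Di.
- case: ifP => t.
    by have [_ ->] := F t m.
  have : ~~ (j <= m <= k) by lia.
  by move=> /Ebc; lia.
- have -> : ~~ adjacent by lia.
  have : m != b :> nat by rewrite /b; case: (up); lia.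
  have : m != c :> nat by rewrite /c; case: (up); lia.
  lia.
- have -> : ~~ strict by apply/negP => /F/(_ m)[]; lia.
  have : ~~ (j <= m <= k) by lia.
  move=> /Ebc; clear - h ij jk inc Ei ni nc; lia.
Qed.

(** * Pattern occurrences as block occurrences *)

Definition o0 : 'I_3 := Ordinal (isT : 0 < 3).
Definition o1 : 'I_3 := Ordinal (isT : 1 < 3).
Definition o2 : 'I_3 := Ordinal (isT : 2 < 3).

Definition pattern (strict adjacent up : bool) : mesh_pattern 3 :=
  MeshPattern (if up then perm123 else perm132)
              (boxes 3 (shaded strict adjacent)).

Lemma enum3 : enum 'I_3 = [:: o0; o1; o2].
Proof. by apply: (inj_map val_inj); rewrite val_enum_ord. Qed.

Lemma forall3 (P : pred 'I_3) : [forall x, P x] = [&& P o0, P o1 & P o2].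
Proof.
apply/forallP/and3P => [H|[h0 h1 h2] x]; first by split.
have : x \in enum 'I_3 by rewrite mem_enum.
by rewrite enum3 !inE => /or3P[] /eqP ->.
Qed.

Lemma occurrenceE n strict adjacent up (pi : 'S_n) (f : {ffun 'I_3 -> 'I_n}) :
  occurrence pi (pattern strict adjacent up) f =
  block_occurrence strict adjacent up pi (f o0) (f o1) (f o2).
Proof.
set i := f o0; set j := f o1; set k := f o2.
pose b := if up then j else k; pose c := if up then k else j.
have incE : increasing f = (i < j < k).
  rewrite /increasing !forall3 /= -/i -/j -/k; lia.
have ordE : i < j < k ->
    order_isomorphic pi (underlying (pattern strict adjacent up)) f =
    (pi i < pi b < pi c).
  move=> _; rewrite /order_isomorphic !forall3 /= -/i -/j -/k /b /c.
  by case: (up); rewrite !permE /=; lia.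
rewrite /occurrence incE; have [hp|hp] := boolP (i < j < k); last first.
  by apply/esym/negP => /and4P[/anchoredP[ij jk _ _ _] jltk _ _]; lia.
rewrite ordE //; have [hv|hv] := boolP (pi i < pi b < pi c); last first.
  (* The anchor below the block and the extremes at its ends already force this order of values,
     since [pi j] and [pi k] differ. *)
  apply/esym/negP => /and4P[/anchoredP[ij jk _ B _] jltk _ /forallP ext].
  have := B j; have := B k; move: (ext j) (ext k) hv.
  have : pi j != pi k :> nat.
    by rewrite val_eqE (inj_eq perm_inj) -val_eqE /=; lia.
  by rewrite /b /c; case: (up); lia.
rewrite /= -(forall_unshadedE strict adjacent hp hv).
have posE : positions f = [:: i.+1; j.+1; k.+1] by rewrite /positions enum3.
have valE : values pi f = [:: (pi i).+1; (pi b).+1; (pi c).+1].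
  have -> : values pi f = sort leq [:: (pi i).+1; (pi b).+1; (pi c).+1].
    rewrite /values enum3 /=.
    apply/(perm_sortP leq_total leq_trans anti_leq).
    rewrite perm_cons /b /c; case: (up) => //.
    exact: permEl (perm_catC [:: _] [:: _]).
  apply: sorted_sort; first exact: leq_trans.
  by move: hv => /= /andP[/ltnW ib /ltnW bc]; rewrite !ltnS ib bc.
rewrite (forall_boxes (empty_box pi f)); last first.
  by case: (strict); case: (adjacent).
rewrite /empty_box posE valE.
apply/allP/forallP => [H m|H ab abs].
  by apply/allP => ab /H /forallP/(_ m).
by apply/forallP => m; have /allP/(_ _ abs) := H m.
Qed.

(** * Counting occurrences through the involution *)

Section Equidistribution.
Variables (n : nat) (strict adjacent : bool).
Implicit Types (pi : 'S_n) (f : {ffun 'I_3 -> 'I_n}).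

(** With [s] the reflection, the anchor stays and the ends of the block swap roles, because their
    order is reversed. *)
Definition reverse_last_two (s : 'S_n) f : {ffun 'I_3 -> 'I_n} :=
  [ffun x => if x == o0 then f o0 else if x == o1 then s (f o2) else s (f o1)].

Lemma reverse_last_two_inj s : injective (reverse_last_two s).
Proof.
move=> f g /ffunP e; apply/ffunP => x.
have := e o0; have := e o1; have := e o2; rewrite !ffunE /=.
move=> /perm_inj e1 /perm_inj e2 e0; apply/eqP.
have : [forall x, f x == g x] by rewrite forall3 e0 e1 e2 !eqxx.
by move/forallP.
Qed.

Lemma num_occurrences_reflect_le up pi :
  num_occurrences pi (pattern strict adjacent up) <=
  num_occurrences (reflect_blocks strict pi) (pattern strict adjacent (~~ up)).
Proof.
rewrite /num_occurrences.
rewrite -(card_imset _ (@reverse_last_two_inj (flip strict pi))).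
apply/subset_leq_card/subsetP => _ /imsetP[f + ->].
rewrite !inE !occurrenceE !ffunE /=; exact: block_occurrence_reflect.
Qed.

Lemma num_occurrences_reflect pi :
  num_occurrences pi (pattern strict adjacent true) =
  num_occurrences (reflect_blocks strict pi) (pattern strict adjacent false).
Proof.
apply/eqP; rewrite eqn_leq num_occurrences_reflect_le /=.
(* The converse inequality is the same one at the reflected permutation. *)
have := num_occurrences_reflect_le false (reflect_blocks strict pi).
by rewrite reflect_blocksK.
Qed.

End Equidistribution.

Lemma equidistributed_pattern strict adjacent :
  pattern strict adjacent true ~d pattern strict adjacent false.
Proof.
move=> n l.
rewrite -[RHS](card_preimset _ (inv_inj (@reflect_blocksK n strict))).
by apply: eq_card => pi; rewrite !inE num_occurrences_reflect.
Qed.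

Theorem theorem3p7 :
  let equidistributed_123_132 (s : seq (nat * nat)) :=
    MeshPattern perm123 (boxes 3 s) ~d MeshPattern perm132 (boxes 3 s) in
  [/\ equidistributed_123_132
        [:: (0,0); (0,2); (0,3); (1,2); (2,0); (2,1); (2,3); (3,0); (3,2)],
      equidistributed_123_132
        [:: (0,0); (0,2); (0,3); (1,2); (2,0); (2,1); (2,2); (2,3); (3,0);
            (3,2)],
      equidistributed_123_132
        [:: (0,0); (0,2); (0,3); (1,1); (1,2); (1,3); (2,0); (2,1); (2,3);
            (3,0); (3,1); (3,2); (3,3)]
    & equidistributed_123_132
        [:: (0,0); (0,2); (0,3); (1,1); (1,2); (1,3); (2,0); (2,1); (2,2);
            (2,3); (3,0); (3,1); (3,2); (3,3)]].
Proof.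
move=> ?; split.
- exact: (equidistributed_pattern false false).
- exact: (equidistributed_pattern false true).
- exact: (equidistributed_pattern true false).
- exact: (equidistributed_pattern true true).
Qed.
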